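(* Let $co$ be the soft convex hull operator in a soft convex space $(X,\zeta,E)$ and $\Omega_{E}, O_{E}\in\mathcal{S}_{E}(X)$. Then the following properties hold: (1) $co(\Phi_{E})=\Phi_{E}$; (2) $\Omega_{E}\,\widetilde{\subseteq}\, co(\Omega_{E})$; (3) if $\Omega_{E}\,\widetilde{\subseteq}\, O_{E}$, then $co(\Omega_{E})\,\widetilde{\subseteq}\, co(O_{E})$; (4) $co(co(\Omega_{E}))=co(\Omega_{E})$; (5) if $\{(\Omega_{i},E): i\in I\}\subseteq \mathcal{S}_{E}(X)$ is a soft upward directed family, then $co\left(\widetilde{\bigcup}_{i\in I} (\Omega_{i},E)\right)=\widetilde{\bigcup}_{i\in I}co(\Omega_{i},E)$; (6) $\Omega_{E}\in\zeta$ if and only if $\Omega_{E}=co(\Omega_{E})$.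
   Context: $X$ is a nonempty set and $E$ a nonempty set of parameters. A soft set on $X$ is a pair $\Omega_E=(\Omega,E)$ with $\Omega:E\to\mathcal{P}(X)$ a function; $\mathcal{S}_E(X)$ is the family of all soft sets on $X$. $\Omega_E\,\widetilde{\subseteq}\,O_E$ means $\Omega(e)\subseteq O(e)$ for all $e\in E$. Unions $\widetilde{\bigcup}$ and intersections $\widetilde{\bigcap}$ of families of soft sets are taken parameterwise: $e\mapsto\bigcup_i\Omega_i(e)$, respectively $e\mapsto\bigcap_i\Omega_i(e)$. $\Phi_E$ is the soft set with value $\emptyset$ at every $e\in E$, and $X_E$ the soft set with value $X$ at every $e\in E$. A family $\{(\Omega_i,E):i\in I\}$ of soft sets on $X$ is soft upward directed if for each pair $i_1,i_2\in I$ there is $i_3\in I$ with $\Omega_{i_1}\,\widetilde{\subseteq}\,\Omega_{i_3}$ and $\Omega_{i_2}\,\widetilde{\subseteq}\,\Omega_{i_3}$. A family $\zeta\subseteq\mathcal{S}_E(X)$ is a soft convex structure on $X$ if: (i) $\Phi_E,X_E\in\zeta$; (ii) the intersection of each family of members of $\zeta$ belongs to $\zeta$; (iii) the union of each soft upward directed family of members of $\zeta$ belongs to $\zeta$. Then $(X,\zeta,E)$ is called a soft convex space. The soft convex hull operator on $(X,\zeta,E)$ is $co(\Omega_E)=\widetilde{\bigcap}\{O_E:\Omega_E\,\widetilde{\subseteq}\,O_E,\ O_E\in\zeta\}$. *)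

(* Defs.v *)
From mathcomp Require Import all_boot.
From mathcomp Require Import boolp classical_sets.

Set Implicit Arguments.
Unset Strict Implicit.
Unset Printing Implicit Defensive.

Local Open Scope classical_set_scope.

(* The parameter set being fixed, the soft set (Omega, E) is the function
   Omega itself. *)
Definition soft_set (X E : Type) : Type := E -> set X.

Definition soft_subset (X E : Type) (A B : soft_set X E) : Prop :=
  forall e : E, A e `<=` B e.

Definition soft_empty (X E : Type) : soft_set X E := fun _ => set0.

Definition soft_full (X E : Type) : soft_set X E := fun _ => setT.

(* A family is indexed by a set D of elements of a type I. The index set may be
   empty: the union is then [soft_empty] and the intersection [soft_full]. *)
Definition soft_bigcup (X E I : Type) (D : set I) (F : I -> soft_set X E) :
  soft_set X E := fun e => \bigcup_(i in D) F i e.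

Definition soft_bigcap (X E I : Type) (D : set I) (F : I -> soft_set X E) :
  soft_set X E := fun e => \bigcap_(i in D) F i e.

Definition soft_upward_directed (X E I : Type) (D : set I)
    (F : I -> soft_set X E) : Prop :=
  forall i1 i2 : I, D i1 -> D i2 ->
    exists i3 : I,
      [/\ D i3, soft_subset (F i1) (F i3) & soft_subset (F i2) (F i3)].

Record soft_convex_structure (X E : Type) (zeta : set (soft_set X E)) : Prop :=
  SoftConvexStructure {
    soft_convex_empty : zeta (@soft_empty X E);
    soft_convex_full : zeta (@soft_full X E);
    soft_convex_bigcap : forall (I : Type) (D : set I) (F : I -> soft_set X E),
      (forall i, D i -> zeta (F i)) -> zeta (soft_bigcap D F);
    soft_convex_bigcup : forall (I : Type) (D : set I) (F : I -> soft_set X E),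
      (forall i, D i -> zeta (F i)) -> soft_upward_directed D F ->
      zeta (soft_bigcup D F)
  }.

Definition soft_convex_hull (X E : Type) (zeta : set (soft_set X E))
    (A : soft_set X E) : soft_set X E :=
  soft_bigcap [set B | soft_subset A B /\ zeta B] id.

(* Main.v *)
Require Import Defs.
From mathcomp Require Import all_boot.
From mathcomp Require Import boolp classical_sets.

(** The convex structure is closed under intersections, so the hull of a soft
set [A] is itself convex, hence the least convex soft set containing [A]
([hull_convex], [sub_hull], [hull_min]).  Everything but the union formula
is the formal behaviour of such a closure operator.

For the union formula, one inclusion is monotonicity.  For the other, the hulls
of an upward directed family again form an upward directed family, because the
hull is monotone; their union is therefore convex, and as it contains the union
of the original family, minimality of the hull applies. *)

Set Implicit Arguments.
Unset Strict Implicit.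
Unset Printing Implicit Defensive.

Local Open Scope classical_set_scope.

Section SoftSubset.
Context {X E : Type}.
Implicit Types A B C : soft_set X E.

Lemma soft_subset_trans A B C :
  soft_subset A B -> soft_subset B C -> soft_subset A C.
Proof. by move=> AB BC e; apply: subset_trans (AB e) (BC e). Qed.

Lemma soft_subset_antisym A B : soft_subset A B -> soft_subset B A -> A = B.
Proof. by move=> AB BA; apply/funext => e; apply/seteqP; split. Qed.

Lemma soft_bigcup_sup (I : Type) (D : set I) (F : I -> soft_set X E) i :
  D i -> soft_subset (F i) (soft_bigcup D F).
Proof. by move=> Di e x Fx; exists i. Qed.

Lemma soft_bigcup_sub (I : Type) (D : set I) (F : I -> soft_set X E) B :
  (forall i, D i -> soft_subset (F i) B) -> soft_subset (soft_bigcup D F) B.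
Proof. by move=> FB e x [i Di Fx]; apply: FB Fx. Qed.

End SoftSubset.

Section Hull.
Context {X E : Type}.
Variable zeta : set (soft_set X E).
Implicit Types A B : soft_set X E.
Local Notation co := (soft_convex_hull zeta).

Lemma sub_hull A : soft_subset A (co A).
Proof. by move=> e x Ax B [AB _]; apply: AB. Qed.

Lemma hull_min A B : soft_subset A B -> zeta B -> soft_subset (co A) B.
Proof. by move=> AB zB e x; apply. Qed.

(** Fewer convex soft sets contain the larger soft set, so intersecting them
removes less. *)
Lemma hull_mono A B : soft_subset A B -> soft_subset (co A) (co B).
Proof.
move=> AB e x coAx C [BC zC]; apply: coAx.
by split=> //; apply: soft_subset_trans BC.
Qed.

Lemma hull_id A : zeta A -> co A = A.
Proof.
move=> zA; apply: soft_subset_antisym; last exact: sub_hull.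
by apply: hull_min zA => e x.
Qed.

(** This is what lets closure under directed unions be applied to the hulls of
a family that need not consist of convex soft sets. *)
Lemma directed_hull (I : Type) (D : set I) (F : I -> soft_set X E) :
  soft_upward_directed D F -> soft_upward_directed D (fun i => co (F i)).
Proof.
move=> dirF i j Di Dj; have [k [Dk ik jk]] := dirF i j Di Dj.
by exists k; split=> //; apply: hull_mono.
Qed.

Hypothesis zeta_convex : soft_convex_structure zeta.

Lemma hull_convex A : zeta (co A).
Proof. by apply: (soft_convex_bigcap zeta_convex) => B []. Qed.

(** Directedness serves only to make the union of the hulls convex, hence to
compete in the intersection that defines the hull of the union. *)
Lemma hull_bigcup (I : Type) (D : set I) (F : I -> soft_set X E) :
  soft_upward_directed D F ->
  co (soft_bigcup D F) = soft_bigcup D (fun i => co (F i)).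
Proof.
move=> dirF; apply: soft_subset_antisym.
  apply: hull_min.
    by move=> e x [i Di Fx]; exists i => //; apply: sub_hull.
  apply: (soft_convex_bigcup zeta_convex); last exact: directed_hull.
  by move=> i _; apply: hull_convex.
by apply: soft_bigcup_sub => i Di; apply: hull_mono; apply: soft_bigcup_sup.
Qed.

End Hull.

Theorem proposition3p1 (X E : Type)
    (X_nonempty : [set: X] !=set0) (E_nonempty : [set: E] !=set0)
    (zeta : set (soft_set X E)) (zeta_convex : soft_convex_structure zeta)
    (Omega O : soft_set X E) :
  let co := soft_convex_hull zeta in
  co (@soft_empty X E) = @soft_empty X E /\
  soft_subset Omega (co Omega) /\
  (soft_subset Omega O -> soft_subset (co Omega) (co O)) /\
  co (co Omega) = co Omega /\
  (forall (I : Type) (D : set I) (F : I -> soft_set X E),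
     soft_upward_directed D F ->
     co (soft_bigcup D F) = soft_bigcup D (fun i => co (F i))) /\
  (zeta Omega <-> Omega = co Omega).
Proof.
move=> co; split; first exact: hull_id (soft_convex_empty zeta_convex).
split; first exact: sub_hull.
split; first exact: hull_mono.
split; first exact: hull_id (hull_convex zeta_convex Omega).
split; first by move=> I D F; apply: hull_bigcup.
split=> [zOmega|->]; first exact: esym (hull_id zOmega).
exact: hull_convex.
Qed.
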